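(* Let $\Sigma=\{a_1,\dots,a_r\}$ be a finite alphabet and let $X=(\{s\},W,\mu_R,\mu_W,\sigma)$, with $W=\{q_1,\dots,q_v\}$, be a star-like PFA over $\Sigma$ in canonical form such that $\mu_R(s,a,s)<1$ for all $a\in\Sigma$ and such that for all $a,b\in\Sigma$, \[ \mu_R(s,a,s)+\sum_{q\in W}\mu_R(s,a,q)\bigl(\mu_W(q,b,q)+\mu_W(q,b,s)\bigr)<1 ; \] let $\delta$ denote the maximum of these terms over $a,b\in\Sigma$. For $q\in W$ let $\eta_q=\sum_{a\in\Sigma}\mu_W(q,a,s)$. Let $\gamma=1/\tilde z$, where $\tilde z$ is the pole of minimum modulus of \[ \tilde{\mathcal Z}_X(z)=\prod_{i=1}^{r}\Bigl(1-\delta\,\mu_R(s,a_i,s)-\sum_{j=1}^{v}\frac{\delta\,\mu_R(s,a_i,q_j)\,\eta_{q_j}\,z}{1-(1-\eta_{q_j})z}\Bigr)^{-1}. \] Then for $n$ sufficiently large and for all $\varepsilon>0$, \[ H(\Sigma^\omega,n,X)\le 2\lceil (1+\varepsilon)\log_{1/\gamma} n\rceil+o(1). \]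
   Context: $\Sigma^\omega$, $\Sigma^*$ denote the infinite and the finite strings over $\Sigma$, and $\Sigma^\infty=\Sigma^*\cup\Sigma^\omega$. For strings $u,v$, $\mathrm{lcp}(u,v)$ is the length of their longest common prefix. A (Mealy-type) probabilistic finite automaton (PFA) over $\Sigma$ is a tuple $X=(R,W,\mu_R,\mu_W,\sigma)$ with a nonempty finite set $R$ of input states, a nonempty finite set $W$ of output states, functions $\mu_R:R\times\Sigma\times(R\cup W)\to[0,1]$ and $\mu_W:W\times\Sigma\times(R\cup W)\to[0,1]$ with $\sum_{p}\mu_R(q,a,p)=1$ for all $q\in R,a\in\Sigma$ and $\sum_{a}\sum_{p}\mu_W(q,a,p)=1$ for all $q\in W$, and an initial distribution $\sigma$ on $R\cup W$. Semantics: in an input state $q$, reading symbol $a$ the PFA moves to $p$ with probability $\mu_R(q,a,p)$; in an output state $q$, with probability $\mu_W(q,a,p)$ it writes $a$ and moves to $p$. The computation on one input symbol starts in an input state and ends when an input state is reached again; its output is the concatenation of written symbols. The computation on a string $t$ is the concatenation of the computations on $t[1],t[2],\dots$, each starting in the input state where the previous one ended; $X(t)$ is the (random) output, so $X$ is a random map $\Sigma^\omega\to\Sigma^\infty$. $X$ is star-like if $R=\{s\}$, $\mu_W(q,a,q')=0$ for all distinct $q,q'\in W$ and all $a$, and $\sum_{a\in\Sigma}\mu_W(q,a,q)<1$ for every $q\in W$. $X$ is in canonical form if $\sigma(s)=1$. Smoothed trie height: for nonempty $S\subseteq\Sigma^\omega$ and $n$, $H(S,n,X)=\max_{A\subseteq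 S,\,|A|=n}\mathbb{E}\bigl[\max_{u,v\in A}\mathrm{lcp}(X(u),X(v))\bigr]$, where distinct strings are perturbed independently. The $o(1)$ term refers to $n\to\infty$. *)

(* Defs.v *)
From HB Require Import structures.
From mathcomp Require Import all_boot all_order all_algebra.
From mathcomp Require Import complex.
From mathcomp Require Import all_classical all_reals all_analysis.

Set Implicit Arguments.
Unset Strict Implicit.
Unset Printing Implicit Defensive.

Import Order.TTheory GRing.Theory Num.Theory.
Import numFieldNormedType.Exports.

Local Open Scope classical_set_scope.
Local Open Scope ring_scope.

(* Infinite strings over Sigma are functions nat -> Sigma; positions start
   at 0. *)

Inductive string (Sigma : finType) : Type :=
  | FinStr of seq Sigma
  | InfStr of (nat -> Sigma).

Definition prefix_of (Sigma : finType) (w : seq Sigma) (x : string Sigma) : Prop :=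
  match x with
  | FinStr s => prefix w s
  | InfStr f => w = mkseq f (size w)
  end.

(* Extended-real valued: it is +oo exactly when x and y are equal infinite
   strings. *)
Definition lcp (R : realType) (Sigma : finType) (x y : string Sigma) : \bar R :=
  ereal_sup [set ((size w)%:R)%:E | w in [set w | prefix_of w x /\ prefix_of w y]].

Record pfa (R : realType) (Sigma : finType) : Type := Pfa {
  instate : finType;
  outstate : finType;
  muR : instate -> Sigma -> instate + outstate -> R;
  muW : outstate -> Sigma -> instate + outstate -> R;
  init : instate + outstate -> R;
  instate_gt0 : (0 < #|instate|)%N;
  outstate_gt0 : (0 < #|outstate|)%N;
  muR_range : forall q a p, 0 <= muR q a p <= 1;
  muW_range : forall q a p, 0 <= muW q a p <= 1;
  init_range : forall p, 0 <= init p <= 1;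
  muR_sum : forall q a, \sum_p muR q a p = 1;
  muW_sum : forall q, \sum_a \sum_p muW q a p = 1;
  init_sum : \sum_p init p = 1 }.

Arguments muR {R Sigma} {_}.
Arguments muW {R Sigma} {_}.
Arguments init {R Sigma} {_}.

Definition state (R : realType) (Sigma : finType) (X : pfa R Sigma) : Type :=
  (instate X + outstate X)%type.

(* A run records the successive states and, for each step, the symbol that is
   read (if the step leaves an input state) or written (if it leaves an output
   state). *)
Record run (R : realType) (Sigma : finType) (X : pfa R Sigma) : Type := Run {
  st : nat -> state X;
  lab : nat -> Sigma }.

Section Runs.
Context (R : realType) (Sigma : finType) (X : pfa R Sigma).

Definition is_in (q : state X) : bool := if q is inl _ then true else false.

Definition reads (rho : run X) (k : nat) : nat :=
  count (fun m => is_in (st rho m)) (iota 0 k).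

Definition written (rho : run X) (k : nat) : seq Sigma :=
  [seq lab rho m | m <- iota 0 k & ~~ is_in (st rho m)].

(* When the run writes infinitely often, written rho k grows without bound, its
   values being prefixes of one another, so the choices made by xget are
   immaterial. *)
Definition output (rho : run X) : string Sigma :=
  if `[< exists N, forall m, (N <= m)%N -> is_in (st rho m) >] then
    FinStr (written rho
      (xget 0%N [set N : nat | forall m, (N <= m)%N -> is_in (st rho m)]))
  else
    InfStr (fun k => nth (lab rho 0) (written rho
      (xget 0%N [set N : nat | (k < size (written rho N))%N])) k).

(* Probability of the step from q to p labelled a, when the first i symbols
   of the input t have been read already. *)
Definition step_prob (t : nat -> Sigma) (i : nat) (q : state X) (a : Sigma)
    (p : state X) : R :=
  match q with
  | inl r => if a == t i then muR r a p else 0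
  | inr w => muW w a p
  end.

Definition path_prob (t : nat -> Sigma) (rho : run X) (N : nat) : R :=
  init (st rho 0) *
  \prod_(k < N) step_prob t (reads rho k) (st rho k) (lab rho k) (st rho k.+1).

Definition cylinder (rho : run X) (N : nat) : set (run X) :=
  [set tau | (forall k, (k <= N)%N -> st tau k = st rho k) /\
             (forall k, (k < N)%N -> lab tau k = lab rho k)].

Definition cylinders : set (set (run X)) :=
  [set C | exists rho N, C = cylinder rho N].

(* rho i is a random run of X on the input u i, and the runs are mutually
   independent. Since E i may be the full set, the product rule covers every
   subfamily. *)
Record indep_runs (n : nat) (u : 'I_n -> nat -> Sigma) (d : measure_display)
    (Omega : measurableType d) (P : probability Omega R)
    (rho : 'I_n -> Omega -> run X) : Prop := IndepRuns {
  runs_measurable : forall i E, <<s cylinders >> E ->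
    measurable (rho i @^-1` E);
  runs_law : forall i tau N,
    P (rho i @^-1` cylinder tau N) = (path_prob (u i) tau N)%:E;
  runs_indep : forall E : 'I_n -> set (run X),
    (forall i, <<s cylinders >> (E i)) ->
    P [set w | forall i, E i (rho i w)] =
    (\prod_(i < n) P (rho i @^-1` E i))%E }.

(* An n-element set of inputs is given by an injective enumeration u.
   The integral depends only on the joint law of the runs, which indep_runs
   determines; the supremum therefore effectively ranges over the n-element
   subsets of S only. Pairs consist of distinct strings. *)
Definition height (S : set (nat -> Sigma)) (n : nat) : \bar R :=
  ereal_sup [set x | exists u : 'I_n -> nat -> Sigma,
    [/\ injective u, (forall i, S (u i)) &
      exists (d : measure_display) (Omega : measurableType d)
        (P : probability Omega R) (rho : 'I_n -> Omega -> run X),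
        indep_runs u P rho /\
        x = (\int[P]_w \big[maxe/0]_(ij : 'I_n * 'I_n | ij.1 != ij.2)
               lcp R (output (rho ij.1 w)) (output (rho ij.2 w)))%E]].

Definition star_like (s : instate X) : Prop :=
  [/\ forall r : instate X, r = s,
      forall (q q' : outstate X) a, q != q' -> muW q a (inr q') = 0 &
      forall q : outstate X, \sum_a muW q a (inr q) < 1].

Definition in_canonical_form (s : instate X) : Prop := init (inl s : state X) = 1.

Definition match_term (s : instate X) (a b : Sigma) : R :=
  muR s a (inl s) +
  \sum_(q : outstate X) muR s a (inr q) * (muW q b (inr q) + muW q b (inl s)).

(* The terms are nonnegative and Sigma is inhabited (by muW_sum and
   outstate_gt0), so the neutral value 0 does not affect the maximum. *)
Definition delta (s : instate X) : R :=
  \big[Order.max/0]_(ab : Sigma * Sigma) match_term s ab.1 ab.2.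

Definition eta (s : instate X) (q : outstate X) : R :=
  \sum_a muW q a (inl s).

Local Open Scope complex_scope.

Definition Ztilde (s : instate X) (z : R[i]) : R[i] :=
  \prod_(a : Sigma)
    (1 - (delta s * muR s a (inl s))%:C
       - \sum_(q : outstate X)
           ((delta s * muR s a (inr q) * eta s q)%:C * z)
           / (1 - (1 - eta s q)%:C * z))^-1.

End Runs.

(* For a rational function, a pole is a point where the modulus tends to +oo.
   Only punctured neighbourhoods matter, so the value given by the convention
   0^-1 = 0 at finitely many points is irrelevant. *)
Definition is_pole (R : realType) (f : R[i] -> R[i]) (z : R[i]) : Prop :=
  `|f w| @[w --> (z : R[i]^o)^'] --> +oo.

Definition is_min_pole (R : realType) (f : R[i] -> R[i]) (z : R[i]) : Prop :=
  is_pole f z /\ forall z', is_pole f z' -> `|z| <= `|z'|.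

Definition logb (R : realType) (b x : R) : R := ln x / ln b.

(* Main.v *)
Require Import Defs.
From mathcomp Require Import all_boot all_order all_algebra.
From mathcomp Require Import complex.
From mathcomp Require Import all_classical all_reals all_analysis.
From mathcomp Require Import measurable_realfun ring lra.

(* Let M(k) be the number of input symbols read when the k-th output symbol is
   written. If two independent outputs agree on their first k symbols, then in
   one of the two runs M(k) is at least what it is in the other. For a fixed
   word w, the probability that a run writes w and reads at least m symbols
   meanwhile is at most delta^(m-1): every symbol read must be skipped or make
   the run write the right next symbol. Hence P(lcp >= k) is at most
   (2 / delta) E[delta^M(k)]. The expectation is at most z^-k whenever
   delta G_a(z) <= 1 for all a, where G_a is the generating function of the
   length of the output for one symbol a, and this holds up to the smallest
   positive pole of Ztilde. So P(lcp >= k) <= (2 / delta) gamma^k, and the union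
   bound over the pairs gives E[max lcp] <= L + O(n^2 gamma^L) for every L. *)

Set Implicit Arguments.
Unset Strict Implicit.
Unset Printing Implicit Defensive.

Import Order.TTheory GRing.Theory Num.Theory.
Import numFieldNormedType.Exports.

Local Open Scope classical_set_scope.
Local Open Scope ring_scope.
Local Open Scope complex_scope.

(** * Finite computations *)

Section Paths.
Context (R : realType) (Sigma : finType) (X : pfa R Sigma).
Implicit Types (t : nat -> Sigma) (i k m N : nat) (w : seq Sigma).

Local Notation Q := (instate X + outstate X)%type.
Local Notation step := (Sigma * Q)%type.
Implicit Types (q : Q) (x : step) (p : seq step).

(* A finite computation from a given state is the list of its steps, each
   recorded as the symbol read or written together with the state reached. *)
Fixpoint paths N : seq (seq step) :=
  if N is N'.+1 then [seq x :: p | x <- enum {: step}, p <- paths N']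
  else [:: [::]].

Fixpoint weight t i q p : R :=
  if p is x :: p' then
    step_prob t i q x.1 x.2 * weight t (i + is_in q) x.2 p'
  else 1.

Fixpoint outp q p : seq Sigma :=
  if p is x :: p' then
    if is_in q then outp x.2 p' else x.1 :: outp x.2 p'
  else [::].

(* Number of symbols read when the k-th symbol is written; meaningful only if
   at least k symbols are written. *)
Fixpoint rd q k p : nat :=
  match p, k with
  | x :: p', k'.+1 => if is_in q then (rd x.2 k p').+1 else rd x.2 k' p'
  | _, _ => 0
  end.

(** Expectation of [F] over the first [N] steps from [q] when [i] input symbols have been read;
    being a finite sum, it can be handled by induction on [N]. *)
Definition pexp t N i q (F : seq step -> R) : R :=
  \sum_(p <- paths N) weight t i q p * F p.

Lemma step_prob_ge0 t i q a q' : 0 <= step_prob t i q a q'.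
Proof.
case: q => [r|u] /=; last by case/andP: (muW_range u a q').
by case: ifP => // _; case/andP: (muR_range r a q').
Qed.

Lemma weight_ge0 t i q p : 0 <= weight t i q p.
Proof.
by elim: p i q => //= x p IH i q; rewrite mulr_ge0 ?step_prob_ge0.
Qed.

Lemma pexp0 t i q F : pexp t 0 i q F = F [::].
Proof. by rewrite /pexp /= big_seq1 mul1r. Qed.

Lemma pexpS t N i q F :
  pexp t N.+1 i q F = \sum_(x : step) step_prob t i q x.1 x.2 *
     pexp t N (i + is_in q) x.2 (fun p => F (x :: p)).
Proof.
rewrite /pexp /= big_allpairs_dep big_enum /=; apply: eq_bigr => x _.
by rewrite big_distrr /=; apply: eq_bigr => p _; rewrite mulrA.
Qed.

Lemma eq_pexp t N i q F G : F =1 G -> pexp t N i q F = pexp t N i q G.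
Proof. by move=> FG; apply: eq_bigr => p _; rewrite FG. Qed.

Lemma ler_pexp t N i q F G :
  (forall p, F p <= G p) -> pexp t N i q F <= pexp t N i q G.
Proof.
by move=> FG; apply: ler_sum => p _; rewrite ler_wpM2l ?weight_ge0.
Qed.

Lemma pexpD t N i q F G :
  pexp t N i q (fun p => F p + G p) = pexp t N i q F + pexp t N i q G.
Proof. by rewrite -big_split; apply: eq_bigr => p _; rewrite mulrDr. Qed.

Lemma pexpZ t N i q c F :
  pexp t N i q (fun p => c * F p) = c * pexp t N i q F.
Proof. by rewrite big_distrr /=; apply: eq_bigr => p _; rewrite mulrCA. Qed.

Lemma pexp_cst0 t N i q : pexp t N i q (fun=> 0) = 0.
Proof. by rewrite /pexp big1 // => p _; rewrite mulr0. Qed.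

Lemma step_prob_sum t i q : \sum_(x : step) step_prob t i q x.1 x.2 = 1.
Proof.
rewrite -(pair_bigA _ (step_prob t i q)) /=.
case: q => [r|u] /=; last exact: muW_sum.
rewrite (bigD1 (t i)) //= eqxx muR_sum big1 ?addr0 // => a /negPf ->.
by rewrite big1.
Qed.

Lemma pexp_cst1 t N i q : pexp t N i q (fun=> 1) = 1.
Proof.
elim: N i q => [|N IH] i q; first by rewrite pexp0.
rewrite pexpS -[RHS](step_prob_sum t i q); apply: eq_bigr => x _.
by rewrite IH mulr1.
Qed.

Lemma pexp_le1 t N i q F : (forall p, F p <= 1) -> pexp t N i q F <= 1.
Proof. by move=> F1; rewrite -(pexp_cst1 t N i q) ler_pexp. Qed.

(** * Star-like automata: conditioning on the first step *)

Section StarLike.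
Variables (s : instate X) (Xstar : star_like s).

Lemma instate_sum (f : instate X -> R) : \sum_r f r = f s.
Proof.
have [all_s _ _] := Xstar.
by rewrite (bigD1 s) //= big1 ?addr0 // => r; rewrite (all_s r) eqxx.
Qed.

Lemma pexp_in t N i F :
  pexp t N.+1 i (inl s) F =
  muR s (t i) (inl s) * pexp t N i.+1 (inl s) (fun p => F ((t i, inl s) :: p))
  + \sum_u muR s (t i) (inr u) *
      pexp t N i.+1 (inr u) (fun p => F ((t i, inr u) :: p)).
Proof.
rewrite pexpS /= addn1.
transitivity (\sum_a \sum_q (if a == t i then muR s a q else 0) *
   pexp t N i.+1 q (fun p => F ((a, q) :: p))).
  by rewrite pair_bigA; apply: eq_bigr => -[a q].
rewrite (bigD1 (t i)) //= eqxx big_sumType instate_sum [X in _ + X]big1 ?addr0//.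
by move=> a /negPf ->; rewrite big1 // => q _; rewrite mul0r.
Qed.

Lemma pexp_out t N i u F :
  pexp t N.+1 i (inr u) F =
  \sum_a (muW u a (inl s) * pexp t N i (inl s) (fun p => F ((a, inl s) :: p))
  + muW u a (inr u) * pexp t N i (inr u) (fun p => F ((a, inr u) :: p))).
Proof.
have [_ star_out _] := Xstar.
rewrite pexpS /= addn0.
transitivity (\sum_a \sum_q muW u a q *
   pexp t N i q (fun p => F ((a, q) :: p))).
  by rewrite pair_bigA; apply: eq_bigr => -[a q].
apply: eq_bigr => a _; rewrite big_sumType instate_sum; congr (_ + _).
rewrite (bigD1 u) //= big1 ?addr0 // => u' u'u.
by rewrite star_out ?mul0r // eq_sym.
Qed.

Lemma sum_muW_stay u : \sum_a muW u a (inr u) = 1 - eta s u.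
Proof.
have [_ star_out _] := Xstar.
rewrite -(muW_sum u) /eta -sumrB; apply: eq_bigr => a _.
rewrite big_sumType instate_sum (bigD1 u) //= [X in _ + (_ + X)]big1.
  by rewrite addr0 addrAC subrr add0r.
by move=> u' u'u; rewrite star_out // eq_sym.
Qed.

Lemma eta_gt0 u : 0 < eta s u.
Proof.
have [_ _ stay_lt1] := Xstar.
by have := stay_lt1 u; rewrite sum_muW_stay gtrBl.
Qed.

Lemma eta_le1 u : eta s u <= 1.
Proof.
rewrite -subr_ge0 -sum_muW_stay; apply: sumr_ge0 => a _.
by case/andP: (muW_range u a (inr u)).
Qed.

Lemma muW_le1 u a : muW u a (inr u) + muW u a (inl s) <= 1.
Proof.
have ge0 b q : 0 <= muW u b q by case/andP: (muW_range u b q).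
rewrite -(muW_sum u) (bigD1 a) //= big_sumType instate_sum.
rewrite [X in _ <= _ + X + _](bigD1 u) //= addrA [X in _ <= X + _ + _]addrC -addrA.
by rewrite lerDl addr_ge0 // sumr_ge0 // => *; rewrite // sumr_ge0.
Qed.

Lemma muR_in_out a : muR s a (inl s) + \sum_u muR s a (inr u) = 1.
Proof. by rewrite -(muR_sum s a) big_sumType instate_sum. Qed.

Lemma muR_ge0 (r : instate X) a q : 0 <= muR r a q.
Proof. by case/andP: (muR_range r a q). Qed.

Lemma muW_ge0 (u : outstate X) a q : 0 <= muW u a q.
Proof. by case/andP: (muW_range u a q). Qed.

Lemma match_term_le_delta a b : match_term s a b <= delta s.
Proof.
exact: (le_bigmax (0 : R) (fun ab => match_term s ab.1 ab.2) (a, b)).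
Qed.

Lemma delta_lt1 : (forall a b, match_term s a b < 1) -> delta s < 1.
Proof. by move=> lt1; apply: bigmax_lt => // -[a b]. Qed.

Lemma Sigma_inhabited : exists a : Sigma, True.
Proof.
have /card_gt0P[u _] := outstate_gt0 X.
case: (pickP (@predT Sigma)) => [a _|noa]; first by exists a.
have := muW_sum u; rewrite big1 => [/eqP|a]; last by have := noa a.
by rewrite eq_sym oner_eq0.
Qed.

(** For fixed [a], the terms summed over [b] are at least the probability of leaving [s], because an
    output state writes some symbol with total probability 1. *)
Lemma delta_gt0 : (forall a, muR s a (inl s) < 1) -> 0 < delta s.
Proof.
have [a _] := Sigma_inhabited; move=> /(_ a) skip_lt1.
rewrite ltNge; apply/negP => delta_le0.
have : \sum_b match_term s a b <= 0.
  by apply: sumr_le0 => b _; apply: le_trans delta_le0; apply: match_term_le_delta.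
apply/negP; rewrite -ltNge.
apply: (@lt_le_trans _ _ (\sum_u muR s a (inr u))).
  by move: (muR_in_out a) skip_lt1 => <-; rewrite ltrDl.
rewrite /match_term big_split /= exchange_big /=.
rewrite ler_wpDl ?sumr_ge0// => [b _|]; first exact: muR_ge0.
apply: ler_sum => u _; rewrite -big_distrr /= big_split /= sum_muW_stay.
by rewrite subrK mulr1.
Qed.

Definition matches w m q p : bool :=
  prefix w (outp q p) && (m <= rd q (size w) p)%N.

(* Reading one more input symbol costs a factor [delta]: it has to be skipped,
   or the first symbol written for it has to be the next symbol of [w]. *)
Lemma pexp_matches : delta s <= 1 -> forall t N i q w m,
  pexp t N i q (fun p => (matches w m q p)%:R) <= delta s ^+ m.-1.
Proof.
have [all_s _ _] := Xstar.
move=> delta_le1 t N.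
have delta_ge0 : 0 <= delta s by exact: bigmax_ge_id.
(* The sharper bound for output states is carried along: averaged over the states entered on reading
   a symbol, its factor builds up [match_term]. *)
suff [] : (forall i q w m,
    pexp t N i q (fun p => (matches w m q p)%:R) <= delta s ^+ m.-1) /\
  (forall i u b w m, pexp t N i (inr u) (fun p => (matches (b :: w) m (inr u) p)%:R)
     <= (muW u b (inr u) + muW u b (inl s)) * delta s ^+ m.-1) by [].
elim: N => [|N [IH1 IH2]].
  split=> [i q w m|i u b w m]; rewrite pexp0 /matches.
    by case: w => [|b w] /=; [case: m => [|m]|]; rewrite /= ?expr0 ?exprn_ge0.
  by rewrite /= mulr_ge0 ?addr_ge0 ?muW_ge0 ?exprn_ge0.
have IH2S i u b w m :
    pexp t N.+1 i (inr u) (fun p => (matches (b :: w) m (inr u) p)%:R)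
    <= (muW u b (inr u) + muW u b (inl s)) * delta s ^+ m.-1.
  rewrite pexp_out (bigD1 b) //= [X in _ + X]big1 ?addr0 => [|a ab].
    rewrite /matches /= !eqxx /= addrC mulrDl lerD // ler_wpM2l ?muW_ge0 //;
      exact: IH1.
  rewrite /matches /=; have -> : (b == a) = false by rewrite eq_sym (negPf ab).
  by rewrite !pexp_cst0 !mulr0 addr0.
split=> // i q w m.
have [m_le1|m_gt1] := leqP m 1.
  have -> : m.-1 = 0%N by case: m m_le1 => [|[]].
  by rewrite expr0; apply: pexp_le1 => p; case: (matches _ _ _ _).
case: w => [|b w].
  rewrite (@eq_pexp _ _ _ _ _ (fun=> 0)) ?pexp_cst0 ?exprn_ge0 //.
  move=> p; rewrite /matches.
  have -> : rd q 0 p = 0%N by case: p.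
  by rewrite leqNgt (ltnW m_gt1) andbF.
case: q => [r|u]; last first.
  by apply: le_trans (IH2S _ _ _ _ _) _; rewrite ler_piMl ?exprn_ge0 ?muW_le1.
rewrite {r}(all_s r) pexp_in; case: m m_gt1 => [|[|m]] //= _.
pose F q p : R := (matches (b :: w) m.+1 q p)%:R.
have -> : pexp t N i.+1 (inl s)
   (fun p => (matches (b :: w) m.+2 (inl s) ((t i, inl s) :: p))%:R) =
   pexp t N i.+1 (inl s) (F (inl s)) by [].
have -> : \sum_u muR s (t i) (inr u) * pexp t N i.+1 (inr u)
   (fun p => (matches (b :: w) m.+2 (inl s) ((t i, inr u) :: p))%:R) =
   \sum_u muR s (t i) (inr u) * pexp t N i.+1 (inr u) (F (inr u)) by [].
apply: (@le_trans _ _ (match_term s (t i) b * delta s ^+ m)); last first.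
  by rewrite exprS ler_wpM2r ?exprn_ge0 ?match_term_le_delta.
rewrite /match_term mulrDl lerD //.
  by rewrite ler_wpM2l ?muR_ge0//; exact: IH1.
rewrite big_distrl /=; apply: ler_sum => u _.
by rewrite -mulrA ler_wpM2l ?muR_ge0//; exact: IH2.
Qed.

(* Generating functions of the lengths of the output written when leaving [u]
   for good, and of the output for one input symbol [a]. *)
Definition gen_out u (z : R) : R := eta s u * z / (1 - (1 - eta s u) * z).

Definition gen_in a z : R :=
  muR s a (inl s) + \sum_u muR s a (inr u) * gen_out u z.

(** For positive [z], the first clause is convergence of the geometric series [gen_out] for the
    states that can be entered on reading [a]. *)
Definition admissible (z : R) : Prop := forall a,
  (forall u, 0 < muR s a (inr u) -> 0 < 1 - (1 - eta s u) * z) /\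
  delta s * gen_in a z <= 1.

Lemma gen_out_ge1 u z : 1 <= z -> 0 < 1 - (1 - eta s u) * z -> 1 <= gen_out u z.
Proof.
by move=> z_ge1 d_gt0; rewrite /gen_out ler_pdivlMr // mul1r; lra.
Qed.

(** The variable delta^M(k), set to 0 on computations that write fewer than [k] symbols. *)
Definition long k q p : R := (k <= size (outp q p))%:R * delta s ^+ rd q k p.

(* With [k] symbols left to write, [z ^- k] in the input state and
   [z ^- k * gen_out u z] in the output state [u] is superharmonic for the
   process weighted by [delta] for every symbol read. *)
Lemma pexp_long t z : delta s <= 1 -> 1 <= z -> admissible z -> forall N i k,
  pexp t N i (inl s) (long k (inl s)) <= z ^- k.
Proof.
move=> delta_le1 z_ge1 zadm N.
have delta_ge0 : 0 <= delta s by exact: bigmax_ge_id.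
have z_gt0 : 0 < z by lra.
have zV_ge0 k : 0 <= z ^- k by rewrite invr_ge0 exprn_ge0 // ltW.
have long0 q p : long 0 q p = 1.
  by rewrite /long; case: p => [|x p] /=; rewrite expr0 mulr1.
suff [] : (forall i k, pexp t N i (inl s) (long k (inl s)) <= z ^- k) /\
  (forall i k u, 0 < 1 - (1 - eta s u) * z ->
    pexp t N i (inr u) (long k (inr u)) <= gen_out u z * z ^- k) by [].
elim: N => [|N [IH1 IH2]].
  split=> [i [|k]|i [|k] u d_gt0]; rewrite pexp0 /long /= ?mul0r //.
  - by rewrite expr0 mulr1 expr0 invr1.
  - by rewrite expr0 mulr1 expr0 invr1 mulr1 gen_out_ge1.
  - by rewrite mulr_ge0 // (le_trans ler01) // gen_out_ge1.
split=> [i [|k]|i [|k] u d_gt0].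
- by rewrite (eq_pexp _ _ _ _ (long0 _)) pexp_cst1 expr0 invr1.
- rewrite pexp_in.
  have -> q : (fun p => long k.+1 (inl s) ((t i, q) :: p)) =
      (fun p => delta s * long k.+1 q p).
    by apply/funext => p; rewrite /long /= exprS mulrCA.
  under eq_bigr => u _.
    have -> : (fun p => long k.+1 (inl s) ((t i, inr u) :: p)) =
      (fun p => delta s * long k.+1 (inr u) p).
      by apply/funext => p; rewrite /long /= exprS mulrCA.
    rewrite pexpZ; over.
  rewrite pexpZ.
  have [dpos zle1] := zadm (t i).
  apply: (@le_trans _ _ (delta s * gen_in (t i) z * z ^- k.+1)); last first.
    by rewrite ler_piMl.
  rewrite /gen_in mulrDr mulrDl lerD //.
    by rewrite mulrCA -mulrA ler_wpM2l // ler_wpM2l ?muR_ge0.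
  rewrite mulr_sumr mulr_suml; apply: ler_sum => u _.
  have := muR_ge0 s (t i) (inr u); rewrite le_eqVlt => /orP[/eqP <-|mu_gt0].
    by rewrite !(mul0r, mulr0).
  rewrite mulrCA -[leRHS]mulrA ler_wpM2l // -mulrA ler_wpM2l ?muR_ge0 //.
  by apply: IH2; exact: dpos.
- by rewrite (eq_pexp _ _ _ _ (long0 _)) pexp_cst1 expr0 invr1 mulr1 gen_out_ge1.
- rewrite pexp_out.
  (* Each written symbol ends the visit to [u] with probability [eta s u] and prolongs it otherwise;
     [gen_out] makes this balance exact. *)
  have -> : gen_out u z * z ^- k.+1 =
      eta s u * z ^- k + (1 - eta s u) * (gen_out u z * z ^- k).
    rewrite /gen_out exprS; field.
    by rewrite expf_neq0 ?gt_eqF //= andbT mulrC.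
  rewrite /eta -/(eta s u) -sum_muW_stay !mulr_suml -big_split /=.
  apply: ler_sum => a _; rewrite lerD // ler_wpM2l ?muW_ge0 //; first exact: IH1.
  exact: IH2.
Qed.

(** * Two independent computations with a common output prefix *)

Definition agree k (q q' : Q) p p' : bool :=
  [&& k <= size (outp q p), k <= size (outp q' p') &
      take k (outp q p) == take k (outp q' p')]%N.

Lemma agree_sym k q q' p p' : agree k q q' p p' = agree k q' q p' p.
Proof. by rewrite /agree andbCA eq_sym. Qed.

(** Once the first computation is fixed, the second has to write a given word while reading at least
    [rd (inl s) k p] symbols, which [pexp_matches] bounds; [pexp_long] then averages over the
    first. *)
Lemma pexp_agree_half t t' z : 0 < delta s <= 1 -> 1 <= z -> admissible z ->
  forall N k,
  pexp t N 0 (inl s) (fun p => pexp t' N 0 (inl s) (fun p' =>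
    (agree k (inl s) (inl s) p p' && (rd (inl s) k p <= rd (inl s) k p')%N)%:R))
  <= (delta s)^-1 * z ^- k.
Proof.
move=> /andP[delta_gt0 delta_le1] z_ge1 zadm N k.
set q : Q := inl s.
have delta_ge0 := ltW delta_gt0.
apply: (@le_trans _ _ (pexp t N 0 q (fun p => (delta s)^-1 * long k q p)));
  last first.
  by rewrite pexpZ ler_wpM2l ?invr_ge0 //; exact: pexp_long.
apply: ler_pexp => p; rewrite /long.
have [k_le|k_gt] := leqP k (size (outp q p)); last first.
  rewrite mul0r mulr0 (@eq_pexp _ _ _ _ _ (fun=> 0)) ?pexp_cst0 // => p'.
  by rewrite /agree leqNgt k_gt.
(* The exponent is one less than the number of symbols read, hence the factor [(delta s)^-1], which
   is at least 1 and so also covers the case of no symbol read. *)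
rewrite mul1r; apply: (@le_trans _ _ (delta s ^+ (rd q k p).-1)); last first.
  case: (rd q k p) => [|m] /=; first by rewrite expr0 mulr1 invf_ge1.
  by rewrite exprS mulKf // gt_eqF.
apply: le_trans (pexp_matches delta_le1 t' N 0 q (take k (outp q p)) _).
apply: ler_pexp => p'; rewrite ler_nat /matches size_takel //.
rewrite /agree k_le /=; case: (leqP k _) => //= k_le'.
by case: eqP => //= ->; rewrite prefix_take.
Qed.

Lemma pexp_swap t t' N i i' q q' (F : seq step -> seq step -> R) :
  pexp t N i q (fun p => pexp t' N i' q' (F p)) =
  pexp t' N i' q' (fun p' => pexp t N i q (F ^~ p')).
Proof.
rewrite /pexp; under eq_bigr do rewrite mulr_sumr.
rewrite exchange_big /=; apply: eq_bigr => p' _.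
by rewrite mulr_sumr; apply: eq_bigr => p _; rewrite mulrCA.
Qed.

(* Of the two computations, one has read at least as many symbols as the other
   when the common prefix is complete. *)
Lemma pexp_agree t t' z : 0 < delta s <= 1 -> 1 <= z -> admissible z ->
  forall N k,
  pexp t N 0 (inl s) (fun p => pexp t' N 0 (inl s) (fun p' =>
    (agree k (inl s) (inl s) p p')%:R)) <= 2 / delta s * z ^- k.
Proof.
move=> delta_bnd z_ge1 zadm N k.
set q : Q := inl s.
have half t1 t2 := pexp_agree_half t1 t2 delta_bnd z_ge1 zadm N k.
have -> : 2 / delta s * z ^- k = (delta s)^-1 * z ^- k + (delta s)^-1 * z ^- k.
  by rewrite -mulrA mulrDl !mul1r.
apply: le_trans (lerD (half t t') (half t' t)).
rewrite [X in _ <= _ + X]pexp_swap -pexpD; apply: ler_pexp => p.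
rewrite -pexpD; apply: ler_pexp => p'.
rewrite -natrD ler_nat (agree_sym k q q p' p).
case: agree => //=; have := leq_total (rd q k p) (rd q k p').
by do 2!case: (_ <= _)%N.
Qed.

End StarLike.
End Paths.

(** * Infinite runs *)

Section RunPaths.
Context (R : realType) (Sigma : finType) (X : pfa R Sigma).
Implicit Types (rho tau : run X) (N : nat).

Local Notation Q := (instate X + outstate X)%type.
Local Notation step := (Sigma * Q)%type.

Definition steps rho j N : seq step :=
  [seq (lab rho k, st rho k.+1) | k <- iota j N].

Lemma size_steps rho j N : size (steps rho j N) = N.
Proof. by rewrite size_map size_iota. Qed.

Lemma written_outp rho N : written rho N = outp (st rho 0) (steps rho 0 N).
Proof.
rewrite /written /steps; elim: N 0%N => //= N IH j.
by case: (is_in (st rho j)) => /=; rewrite IH.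
Qed.

Lemma path_prob_weight t rho N :
  path_prob t rho N = init (st rho 0) * weight t 0 (st rho 0) (steps rho 0 N).
Proof.
rewrite /path_prob; congr (_ * _).
have -> : 0%N = reads rho 0 by [].
(* Generalised to start at step [j], after [reads rho j] symbols have been read. *)
suff H j : \prod_(k < N) step_prob t (reads rho (j + k)) (st rho (j + k))
    (lab rho (j + k)) (st rho (j + k).+1) =
    weight t (reads rho j) (st rho j) (steps rho j N) by exact: (H 0%N).
elim: N j => [|N IH] j; first by rewrite big_ord0.
rewrite big_ord_recl /= addn0; congr (_ * _).
have -> : (reads rho j + is_in (st rho j) = reads rho j.+1)%N.
  by rewrite /reads -[in RHS]addn1 iotaD count_cat /= add0n addn0.
rewrite -IH; apply: eq_bigr => k _.
by rewrite /bump /= add1n addSnnS.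
Qed.

Lemma mem_paths N (p : seq step) : (p \in paths X N) = (size p == N).
Proof.
elim: N p => [|N IH] [|x p] //=.
- by apply/negbTE/negP => /allpairsP[[y p'] []].
- rewrite eqSS -IH; apply/allpairsP/idP => [[[y p'] /= [_ ? [_ ->]]] //|pN].
  by exists (x, p); rewrite mem_enum.
Qed.

(** Cylinders indexed by finite data instead of a run: for each [N], finitely many of them partition
    the runs. *)
Definition cyl N (q : Q) p : set (run X) :=
  [set rho | st rho 0 = q /\ steps rho 0 N = p].

Lemma cylinderE rho N : cylinder rho N = cyl N (st rho 0) (steps rho 0 N).
Proof.
apply/seteqP; split=> tau [].
  move=> eqst eqlab; split; first exact: eqst.
  apply/eq_in_map => k; rewrite mem_iota add0n => /= kN.
  by rewrite eqlab // eqst.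
move=> eq0 /eq_in_map eqk.
have {}eqk k : (k < N)%N -> (lab tau k, st tau k.+1) = (lab rho k, st rho k.+1).
  by move=> kN; apply: eqk; rewrite mem_iota.
by split=> [[|k]|k] kN //; have [] := eqk _ kN.
Qed.

(** The path is padded with a constant step, so that every [cyl] with a path of the right length is
    one of the generating cylinders. *)
Lemma run_of_path (q : Q) p : exists2 rho : run X,
  st rho 0 = q & steps rho 0 (size p) = p.
Proof.
have [a0 _] := Sigma_inhabited X.
exists (Run (fun k => if k is k'.+1 then (nth (a0, q) p k').2 else q)
            (fun k => (nth (a0, q) p k).1)) => //.
rewrite -[RHS](mkseq_nth (a0, q)); apply: eq_map => k /=.
by case: (nth _ _ _).
Qed.

Lemma cyl_cylinder N q p : size p = N ->
  exists2 rho, st rho 0 = q /\ steps rho 0 N = p & cyl N q p = cylinder rho N.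
Proof.
move=> <-; have [rho rho0 rhop] := run_of_path q p.
by exists rho; rewrite // cylinderE rho0 rhop.
Qed.

Lemma prefix_written rho N N' : (N <= N')%N ->
  prefix (written rho N) (written rho N').
Proof.
by move=> /subnKC <-; rewrite /written iotaD filter_cat map_cat prefix_prefix.
Qed.

Lemma written_unbounded rho :
  ~ (exists N, forall m, (N <= m)%N -> is_in (st rho m)) ->
  forall k, exists N, (k <= size (written rho N))%N.
Proof.
move=> inf; elim=> [|k [N kN]]; first by exists 0%N.
have [m Nm out_m] : exists2 m, (N <= m)%N & ~~ is_in (st rho m).
  apply: contrapT => no; apply: inf; exists N => m Nm; apply/negPn/negP => out_m.
  by apply: no; exists m.
exists m.+1; rewrite /written -(addn1 m) iotaD filter_cat map_cat size_cat /= add0n.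
rewrite out_m /= addn1 ltnS (leq_trans kN) //.
by apply: size_prefix; exact: prefix_written.
Qed.

(** A finite prefix of the output is already complete after finitely many steps, also when the
    output is infinite. *)
Lemma prefix_of_output rho w : prefix_of w (output rho) ->
  exists N, prefix w (written rho N).
Proof.
rewrite /output; case: ifPn => [_ /= wp|/asboolPn inf]; first by eexists; exact: wp.
move=> /= ->; set n := size w; set f := fun k => nth _ _ _.
have [N nN] := written_unbounded inf n.
exists N; rewrite prefixE size_mkseq; apply/eqP.
apply: (@eq_from_nth _ (lab rho 0)); first by rewrite size_takel // size_mkseq.
move=> k; rewrite size_takel // => kn.
rewrite nth_take // nth_mkseq // /f.
(* The time [M] chosen by [xget] may come before or after [N]; either way one written word is a
   prefix of the other, so both have the same [k]-th symbol. *)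
case: xgetP => [M _ /= kM|/(_ N) /= ]; last by rewrite (leq_trans kn nN).
have [MN|NM] := leqP M N.
  have /prefixP[r ->] := prefix_written rho MN; by rewrite nth_cat kM.
have /prefixP[r ->] := prefix_written rho (ltnW NM).
by rewrite nth_cat (leq_trans kn nN).
Qed.

Definition agree_at N k rho tau : bool :=
  agree k (st rho 0) (st tau 0) (steps rho 0 N) (steps tau 0 N).

(** In terms of a common word, agreement visibly persists when the runs are continued. *)
Lemma agree_atP N k rho tau : reflect
  (exists w, [/\ size w = k, prefix w (written rho N) & prefix w (written tau N)])
  (agree_at N k rho tau).
Proof.
rewrite /agree_at /agree -!written_outp; apply: (iffP and3P) => [[kr kt /eqP rt]|].
  exists (take k (written rho N)); split; first by rewrite size_takel.
    exact: prefix_take.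
  by rewrite rt prefix_take.
move=> [w [<- wr wt]]; split; [exact: size_prefix|exact: size_prefix|].
by move: wr wt; rewrite !prefixE => /eqP -> /eqP ->.
Qed.

Lemma agree_at_le N N' k rho tau : (N <= N')%N ->
  agree_at N k rho tau -> agree_at N' k rho tau.
Proof.
move=> NN' /agree_atP[w [wk wr wt]]; apply/agree_atP; exists w.
split=> //; [apply: prefix_trans wr _|apply: prefix_trans wt _];
  exact: prefix_written.
Qed.

Lemma prefix_of_agree rho tau w k : (k <= size w)%N ->
  prefix_of w (output rho) -> prefix_of w (output tau) ->
  exists N, agree_at N k rho tau.
Proof.
move=> kw /prefix_of_output[N wr] /prefix_of_output[M wt].
exists (maxn N M); apply/agree_atP; exists (take k w); split.
- by rewrite size_takel.
- apply: prefix_trans (prefix_take _ _) _; apply: prefix_trans wr _.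
  by apply: prefix_written; rewrite leq_maxl.
- apply: prefix_trans (prefix_take _ _) _; apply: prefix_trans wt _.
  by apply: prefix_written; rewrite leq_maxr.
Qed.

End RunPaths.

(** * Union bound and integrals of counting functions *)

Section MeasureFacts.
Context d (Omega : measurableType d) (R : realType).

Lemma measure_bigsetU_le (mu : measure Omega R) (I : Type) (r : seq I)
    (A : I -> set Omega) : (forall i, measurable (A i)) ->
  (mu (\big[setU/set0]_(i <- r) A i) <= \sum_(i <- r) mu (A i))%E.
Proof.
move=> mA; elim: r => [|i r IH]; first by rewrite !big_nil measure0.
rewrite !big_cons; apply: le_trans (measureU2 _ _ _) _ => //.
  exact: bigsetU_measurable.
exact: leeD2l.
Qed.

(* No measurability is needed: the integral of a nonnegative function is the
   supremum of the integrals of the simple functions below it. *)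
Lemma ge0_le_integralT (mu : measure Omega R) (f g : Omega -> \bar R) :
  (forall x, 0 <= f x)%E -> (forall x, f x <= g x)%E ->
  (\int[mu]_x f x <= \int[mu]_x g x)%E.
Proof.
move=> f0 fg; have g0 x : (0 <= g x)%E := le_trans (f0 x) (fg x).
rewrite !ge0_integralTE //; apply: ereal_sup_le => _ [h hf <-].
by exists h => // x; exact: le_trans (hf x) (fg x).
Qed.

(** The series counts the events [B k] that occur, so its expectation is the sum of their
    probabilities, which a geometric series dominates. *)
Lemma integral_le_geometric (P : probability Omega R) (f : Omega -> \bar R)
    (B : nat -> set Omega) (l c g : R) :
  (forall k, measurable (B k)) -> 0 <= l -> 0 <= c -> 0 < g < 1 ->
  (forall k, P (B k) <= (c * g ^+ k)%:E)%E ->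
  (forall x, 0 <= f x)%E ->
  (forall x, f x <= l%:E + \sum_(0 <= k <oo) (\1_(B k) x)%:E)%E ->
  (\int[P]_x f x <= (l + c / (1 - g))%:E)%E.
Proof.
move=> mB l_ge0 c_ge0 /andP[g_gt0 g_lt1] PB f_ge0 fB.
have ind_ge0 k x : (0 <= (\1_(B k) x)%:E :> \bar R)%E by rewrite lee_fin.
have mind k : measurable_fun setT (EFin \o (\1_(B k) : Omega -> R)).
  by apply/measurable_EFinP; exact: measurable_indic.
apply: le_trans (ge0_le_integralT _ f_ge0 fB) _.
rewrite ge0_integralD //; last 2 first.
- by move=> x _; apply: nneseries_ge0.
- apply: (@ge0_emeasurable_sum _ _ _ setT (fun k x => (\1_(B k) x)%:E) xpredT).
    by move=> k x _ _; exact: ind_ge0.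
  by move=> k _; exact: mind.
rewrite integral_cst // [X in (_ * X)%E](@probability_setT _ _ _ P) mule1 EFinD.
rewrite leeD2l //.
rewrite integral_nneseries //.
under eq_eseriesr => k _ do rewrite integral_indic // setIT.
apply: lime_le; first by apply: is_cvg_nneseries => k _ _; exact: measure_ge0.
apply: nearW => N; apply: (@le_trans _ _ (\sum_(0 <= k < N) (c * g ^+ k)%:E)%E).
  by apply: lee_sum => k _; exact: PB.
rewrite sumEFin lee_fin; have := geometric_le_lim N c_ge0 g_gt0.
by rewrite gtr0_norm // => /(_ g_lt1).
Qed.

End MeasureFacts.

(** * From independent random runs to finite computations *)

Section IndependentRuns.
Context (R : realType) (Sigma : finType) (X : pfa R Sigma).
Context (s : instate X) (Xstar : star_like s) (Xcanonical : in_canonical_form s).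
Context n (u : 'I_n -> nat -> Sigma) d (Omega : measurableType d).
Context (P : probability Omega R) (rho : 'I_n -> Omega -> run X).
Hypothesis rhoP : indep_runs u P rho.

Local Notation Q := (instate X + outstate X)%type.
Local Notation step := (Sigma * Q)%type.

Lemma init_eq0 (q : Q) : q != inl s -> init q = 0.
Proof.
move=> qs; have := init_sum X; rewrite (bigD1 (inl s)) //= Xcanonical.
move/(canRL (addKr _)); rewrite addNr => /eqP.
have ge0 q' : 0 <= @init R Sigma X q' by case/andP: (init_range q').
by rewrite psumr_eq0 // => /allP/(_ q (mem_index_enum q)); rewrite qs /= => /eqP.
Qed.

Lemma cyl_sigma N q p : size p = N -> <<s @cylinders R Sigma X >> (cyl N q p).
Proof.
move=> pN; have [tau _ ->] := cyl_cylinder q pN.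
by apply: sub_sigma_algebra; exists tau, N.
Qed.

Lemma measurable_cyl i N q p : measurable (rho i @^-1` cyl N q p).
Proof.
have [pN|pN] := eqVneq (size p) N.
  exact: (runs_measurable rhoP i (cyl_sigma q pN)).
rewrite (_ : _ @^-1` _ = set0) //; apply/seteqP; split=> // w [_ eq_p].
by move: pN; rewrite -eq_p size_steps eqxx.
Qed.

Lemma cyl_prob i N q p : size p = N ->
  P (rho i @^-1` cyl N q p) = (init q * weight (u i) 0 q p)%:E.
Proof.
move=> pN; have [tau [tau0 taup] ->] := cyl_cylinder q pN.
by rewrite (runs_law rhoP) path_prob_weight tau0 taup.
Qed.

Lemma cyl_prob2 i j N q p q' p' : i != j -> size p = N -> size p' = N ->
  P (rho i @^-1` cyl N q p `&` rho j @^-1` cyl N q' p') =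
  ((init q * weight (u i) 0 q p) * (init q' * weight (u j) 0 q' p'))%:E.
Proof.
move=> ij pN p'N; have ji : j != i by rewrite eq_sym.
(* The full set at all other indices specialises mutual independence to the pair [i], [j]. *)
pose E k := if k == i then cyl N q p else if k == j then cyl N q' p' else setT.
have mE k : <<s @cylinders R Sigma X >> (E k).
  rewrite /E; case: ifP => _; first exact: cyl_sigma.
  case: ifP => _; first exact: cyl_sigma.
  by move=> M [[M0 MC _] _]; rewrite -(setD0 setT); exact: MC.
rewrite (_ : _ `&` _ = [set w | forall k, E k (rho k w)]); last first.
  apply/seteqP; split=> w /=.
    move=> [wi wj] k; rewrite /E; have [->|_] := eqVneq k i; first exact: wi.
    by have [->|_] := eqVneq k j; first exact: wj.
  move=> Ew; have := Ew i; have := Ew j.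
  by rewrite /E !eqxx (negPf ji).
rewrite (runs_indep rhoP mE) (bigD1 i) //= (bigD1 j) //= big1 => [|k]; last first.
  move=> /andP[/negPf ki /negPf kj].
  by rewrite /E ki kj preimage_setT probability_setT.
by rewrite mule1 /E !eqxx (negPf ji) !cyl_prob // EFinM.
Qed.

Definition agree_event N k i j : set Omega :=
  [set w | agree_at N k (rho i w) (rho j w)].

(** The event depends only on the first [N] steps of the two runs, so it is a finite union of
    intersections of cylinder events; measurability and the probability bound both start from
    here. *)
Lemma agree_eventE N k i j : agree_event N k i j =
  \big[setU/set0]_(pp <- [seq pp <- [seq (x, y) |
       x <- [seq (q, p) | q <- enum {: Q}, p <- paths X N],
       y <- [seq (q, p) | q <- enum {: Q}, p <- paths X N]] |
       agree k pp.1.1 pp.2.1 pp.1.2 pp.2.2])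
    (rho i @^-1` cyl N pp.1.1 pp.1.2 `&` rho j @^-1` cyl N pp.2.1 pp.2.2).
Proof.
rewrite -bigcup_seq; apply/seteqP; split=> w.
  move=> ag; exists ((st (rho i w) 0, steps (rho i w) 0 N),
                     (st (rho j w) 0, steps (rho j w) 0 N)) => //=.
  rewrite mem_filter /=; apply/andP; split; first exact: ag.
  by rewrite !allpairs_f // ?mem_enum // mem_paths size_steps.
move=> [[[q p] [q' p']]] /=; rewrite mem_filter => /andP[/= ag _].
by move=> [[eq1 eq2] [eq3 eq4]]; rewrite /agree_event /= /agree_at eq1 eq2 eq3 eq4.
Qed.

Lemma measurable_agree_event N k i j : measurable (agree_event N k i j).
Proof.
rewrite agree_eventE; apply: bigsetU_measurable => pp _.
by apply: measurableI; exact: measurable_cyl.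
Qed.

Lemma sum_weight N k (F : Q * seq step -> R) :
  \sum_(x <- [seq (q, p) | q <- enum {: Q}, p <- paths X N])
    init x.1 * weight (u k) 0 x.1 x.2 * F x =
  pexp (u k) N 0 (inl s) (fun p => F (inl s, p)).
Proof.
rewrite big_allpairs_dep big_enum /= (bigD1 (inl s)) //= [X in _ + X]big1 ?addr0.
  by apply: eq_bigr => p _; rewrite Xcanonical mul1r.
by move=> q qs; rewrite big1 // => p _; rewrite init_eq0 // !mul0r.
Qed.

(** Subadditivity and independence lead to a double sum over paths; the initial distribution sits at
    [s], so this sum is the one bounded by [pexp_agree]. *)
Lemma agree_event_prob z N k i j : 0 < delta s <= 1 -> 1 <= z ->
  admissible s z -> i != j ->
  (P (agree_event N k i j) <= (2 / delta s * z ^- k)%:E)%E.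
Proof.
move=> delta_bnd z_ge1 zadm ij; rewrite agree_eventE.
apply: le_trans (measure_bigsetU_le _ _ _) _ => [pp|].
  by apply: measurableI; exact: measurable_cyl.
pose wgt k (x : Q * seq step) := init x.1 * weight (u k) 0 x.1 x.2.
rewrite (@eq_big_seq _ _ _ _ _ _ (fun pp => (wgt i pp.1 * wgt j pp.2)%:E));
  last first.
  move=> pp; rewrite mem_filter => /andP[_ /allpairsP[[x y] /= [xP yP ->]]].
  have size_snd x' : x' \in [seq (q, p) | q <- enum {: Q}, p <- paths X N] ->
      size x'.2 = N.
    by move=> /allpairsP[[q p] /= [_ pN ->]]; apply/eqP; rewrite -mem_paths.
  by rewrite cyl_prob2 ?size_snd.
rewrite sumEFin lee_fin big_filter big_mkcond big_allpairs_dep /=.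
apply: le_trans (pexp_agree Xstar (u i) (u j) delta_bnd z_ge1 zadm N k).
rewrite -(sum_weight N i (fun x => pexp (u j) N 0 (inl s) (fun p' =>
  (agree k x.1 (inl s) x.2 p')%:R))).
apply: ler_sum => x _.
rewrite -(sum_weight N j (fun y => (agree k x.1 y.1 x.2 y.2)%:R)).
rewrite mulr_sumr; apply: ler_sum => y _.
by case: ifP => _; rewrite ?mulr1 ?mulr0.
Qed.

Definition common_prefix k i j : set Omega := \bigcup_N agree_event N k i j.

Lemma measurable_common_prefix k i j : measurable (common_prefix k i j).
Proof. by apply: bigcup_measurable => N _; exact: measurable_agree_event. Qed.

(** The events increase with [N] and their bound is uniform in [N], so continuity from below carries
    it to the union. *)
Lemma common_prefix_prob z k i j : 0 < delta s <= 1 -> 1 <= z ->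
  admissible s z -> i != j ->
  (P (common_prefix k i j) <= (2 / delta s * z ^- k)%:E)%E.
Proof.
move=> delta_bnd z_ge1 zadm ij.
have cvgP : P (agree_event N k i j) @[N --> \oo] --> P (common_prefix k i j).
  apply: nondecreasing_cvg_mu.
  - by move=> N; exact: measurable_agree_event.
  - exact: measurable_common_prefix.
  - move=> N M NM; apply/subsetPset => w; exact: agree_at_le.
apply: cvge_le cvgP; apply: nearW => N; exact: agree_event_prob.
Qed.

Definition max_lcp w : \bar R :=
  \big[maxe/0]_(ij : 'I_n * 'I_n | ij.1 != ij.2)
    lcp R (output (rho ij.1 w)) (output (rho ij.2 w)).

(** The maximum exceeds [L] by at most the number of lengths above [L] at which some pair still
    agrees; the event for each length is controlled by a union bound over the pairs. *)
Lemma integral_max_lcp z (L : nat) : 0 < delta s <= 1 -> 1 < z ->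
  admissible s z ->
  (\int[P]_w max_lcp w <=
   (L%:R + n%:R ^+ 2 * (2 / delta s) * z ^- L.+1 / (1 - z^-1))%:E)%E.
Proof.
move=> delta_bnd z_gt1 zadm.
have z_gt0 : 0 < z by lra.
have C_ge0 : 0 <= 2 / delta s by rewrite divr_ge0 //; case/andP: delta_bnd => /ltW.
have zX_ge0 k : 0 <= z ^- k by rewrite invr_ge0 exprn_ge0 // ltW.
pose B k := \big[setU/set0]_(ij : 'I_n * 'I_n | ij.1 != ij.2)
   common_prefix (L.+1 + k) ij.1 ij.2.
apply: (@integral_le_geometric _ _ _ P max_lcp B).
- by move=> k; apply: bigsetU_measurable => ij _; exact: measurable_common_prefix.
- exact: ler0n.
- by apply: mulr_ge0 => //; apply: mulr_ge0 => //; rewrite exprn_ge0.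
- by rewrite invr_gt0 z_gt0 invf_lt1.
- move=> k; rewrite /B -big_filter.
  apply: le_trans (measure_bigsetU_le _ _ _) _.
    by move=> ij; exact: measurable_common_prefix.
  rewrite big_filter.
  (* All n^2 ordered pairs are counted; the diagonal ones only add nonnegative terms. *)
  apply: (@le_trans _ _
    (\sum_(ij : 'I_n * 'I_n) (2 / delta s * z ^- (L.+1 + k))%:E)%E).
    rewrite [leRHS](bigID (fun ij => ij.1 != ij.2)) /=.
    rewrite -[leLHS]adde0 leeD //.
      by apply: lee_sum => ij ij12; apply: common_prefix_prob => //; exact: ltW.
    by apply: sume_ge0 => ij _; rewrite lee_fin mulr_ge0.
  rewrite sumEFin lee_fin sumr_const card_prod card_ord -[leLHS]mulr_natl.
  by rewrite natrM -expr2 exprD invfM exprVn !mulrA.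
- move=> w; rewrite /max_lcp; elim/big_ind: _ => // [x y x0 y0|ij _].
    by rewrite le_max x0.
  apply: ereal_sup_ubound; exists [::] => //.
  by split; case: (output _) => [v|v] //=; rewrite prefix0s.
- have sum_ge0 w : (0 <= \sum_(0 <= k <oo) (\1_(B k) w)%:E :> \bar R)%E.
    by apply: nneseries_ge0 => k _ _; rewrite lee_fin.
  move=> w; apply/bigmax_leP; split; first by rewrite adde_ge0.
  move=> ij ij12; apply/ereal_supP => _ [v [v1 v2] <-].
  have [vL|Lv] := leqP (size v) L.
    by rewrite -[leLHS]adde0 leeD // lee_fin ler_nat.
  (* A common word [v] longer than [L] places [w] in [B k] for every [k < size v - L], so the series
     is at least [size v - L]. *)
  rewrite -(subnKC (ltnW Lv)) natrD EFinD leeD2l //.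
  apply: le_trans (nneseries_lim_ge (size v - L) _); last first.
    by move=> k _ _; rewrite lee_fin.
  rewrite sumEFin lee_fin.
  have -> : (size v - L)%:R = \sum_(0 <= k < size v - L) (1 : R).
    by rewrite sumr_const_nat subn0.
  rewrite !big_mkord.
  apply: ler_sum => k _; rewrite indicE mem_set //.
  rewrite /B -bigcup_seq_cond; exists ij => /=; first by rewrite mem_index_enum.
  have [|N ag] := @prefix_of_agree _ _ _ _ _ _ (L.+1 + k) _ v1 v2.
    by rewrite addSn -ltn_subRL.
  by exists N.
Qed.

End IndependentRuns.

(** * The minimal pole *)

Section PoleFacts.
Context (K : numFieldType) (F : set_system K) {FF : ProperFilter F}.
Implicit Types (f : K -> K) (z w : K).

Lemma cvg_not_pole f z : f w @[w --> F] --> z -> ~ (`|f w| @[w --> F] --> +oo).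
Proof.
move=> fz pole.
have big : \forall w \near F, `|z| + 1 < `|f w|.
  by apply: (cvgryPgtr _).1 pole _ _; rewrite rpredD ?normr_real ?real1.
have small : \forall w \near F, `|z - f w| < 1.
  by have /cvgr_dist_lt/(_ _ ltr01) := fz.
have [w [lt1 lt2]] := filter_ex (filterI big small).
have := ler_normB z (z - f w); rewrite opprB addrC subrK => le3.
by have := lt_le_trans lt1 le3; rewrite ltrD2l => /(lt_trans lt2); rewrite ltxx.
Qed.

(** All factors converge and one limit is 0, so their product tends to 0. They must not vanish along
    [F], since the convention [0^-1 = 0] would break the divergence. *)
Lemma prod_inv_pole (I : finType) (f : I -> K -> K) (l : I -> K) :
  (forall i, f i w @[w --> F] --> l i) -> (exists i, l i = 0) ->
  (forall i, \forall w \near F, f i w != 0) ->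
  `|\prod_i (f i w)^-1| @[w --> F] --> +oo.
Proof.
move=> fl [i li0] /filter_forall fne0.
have Gz : \prod_i f i w @[w --> F] --> (0 : K).
  have -> : (0 : K) = \prod_i l i by rewrite (bigD1 i) //= li0 mul0r.
  by apply: cvg_big => //; exact: mul_continuous.
apply/cvgryPgtr => A Areal.
have A1_gt0 : 0 < (`|A| + 1)^-1 by rewrite invr_gt0 ltr_wpDl.
have small : \forall w \near F, `|\prod_i f i w| < (`|A| + 1)^-1.
  by have /cvgr0Pnorm_lt/(_ _ A1_gt0) := Gz.
near=> w.
rewrite prodfV normfV; apply: le_lt_trans (real_ler_norm Areal) _.
apply: (@lt_le_trans _ _ (`|A| + 1)); first by rewrite ltrDl.
have pos : 0 < `|\prod_i f i w|.
  by rewrite normr_gt0; apply/prodf_neq0 => j _; move: j; near: w.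
rewrite -[leLHS]invrK lef_pV2 ?posrE //.
by apply: ltW; near: w.
Unshelve. all: by end_near. Qed.

(** * The factors of [Ztilde] as rational functions, and their zeros *)

Section Factor.
Context (I : finType) (a0 : K) (a c : I -> K) (z : K).
Hypothesis Fz : w @[w --> F] --> z.

Definition factor w : K := 1 - a0 - \sum_i (a i * w) / (1 - c i * w).

(** A term with [a i = 0] is identically 0, even where its denominator vanishes. *)
Definition denom_neq0 w := forall i, a i != 0 -> 1 - c i * w != 0.

Lemma cvg_denom i : 1 - c i * w @[w --> F] --> 1 - c i * z.
Proof.
by apply: cvgB; [exact: cvg_cst|apply: cvgM; [exact: cvg_cst|]].
Qed.

Lemma cvg_factor : denom_neq0 z -> factor w @[w --> F] --> factor z.
Proof.
move=> dz; apply: cvgB; first exact: cvg_cst.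
apply: cvg_big => [|i _]; first exact: add_continuous.
have [->|ai_neq0] := eqVneq (a i) 0.
  rewrite !mul0r; under eq_fun do rewrite !mul0r.
  exact: cvg_cst.
apply: cvgM; first by apply: cvgM; [exact: cvg_cst|].
by apply: cvgV; [exact: dz|exact: cvg_denom].
Qed.

(** The negated difference quotient of [factor]; on the diagonal, the negated derivative. *)
Definition slope y w : K := \sum_i a i / (1 - c i * w) / (1 - c i * y).

Lemma factorB y w : denom_neq0 y -> denom_neq0 w ->
  factor w - factor y = - ((w - y) * slope y w).
Proof.
move=> dy dw.
have -> : factor w - factor y =
    \sum_i (a i * y) / (1 - c i * y) - \sum_i (a i * w) / (1 - c i * w).
  by rewrite /factor; ring.
rewrite -sumrB mulr_sumr -sumrN; apply: eq_bigr => i _.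
have [->|ai_neq0] := eqVneq (a i) 0.
  by rewrite !(mul0r, mulr0) subr0 oppr0.
by field; rewrite dy // dw.
Qed.

Lemma cvg_slope : denom_neq0 z -> slope z w @[w --> F] --> slope z z.
Proof.
move=> dz; apply: cvg_big => [|i _]; first exact: add_continuous.
have [->|ai_neq0] := eqVneq (a i) 0.
  rewrite !mul0r; under eq_fun do rewrite !mul0r.
  exact: cvg_cst.
apply: cvgM; last exact: cvg_cst.
apply: cvgM; first exact: cvg_cst.
by apply: cvgV; [exact: dz|exact: cvg_denom].
Qed.

Lemma denom_neq0_near : denom_neq0 z -> \forall w \near F, denom_neq0 w.
Proof.
move=> dz; apply: filter_forall => i.
have [_|ai_neq0] := eqVneq (a i) 0; first exact: nearW.
have dF := cvgr_neq0 _ (@cvg_denom i) (dz i ai_neq0).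
by near=> w => _; near: w; exact: dF.
Unshelve. all: by end_near. Qed.

(** A zero with nonzero derivative is isolated: near it, [factor w] is [z - w] times a nonzero
    slope. At any other point continuity suffices. *)
Lemma factor_neq0_near : (\forall w \near F, w != z) ->
  denom_neq0 z -> slope z z != 0 -> \forall w \near F, factor w != 0.
Proof.
move=> wz dz slope_neq0.
have [fz0|fz_neq0] := eqVneq (factor z) 0; last first.
  exact: cvgr_neq0 (cvg_factor dz) fz_neq0.
have sw : \forall w \near F, slope z w != 0.
  exact: cvgr_neq0 (cvg_slope dz) slope_neq0.
have dw := denom_neq0_near dz.
near=> w.
have -> : factor w = factor w - factor z by rewrite fz0 subr0.
rewrite factorB //; last by near: w.
by rewrite oppr_eq0 mulf_neq0 ?subr_eq0 //; near: w.
Unshelve. all: by end_near. Qed.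

End Factor.
End PoleFacts.

(** * Real poles of [Ztilde] and the minimal one *)

Section MinimalPole.
Context (R : realType) (Sigma : finType) (X : pfa R Sigma).
Context (s : instate X) (Xstar : star_like s).
Hypothesis skip_lt1 : forall a, muR s a (inl s) < 1.
Hypothesis match_lt1 : forall a b, match_term s a b < 1.

Definition input_factor (a : Sigma) : R[i] -> R[i] :=
  factor (delta s * muR s a (inl s))%:C
    (fun u => (delta s * muR s a (inr u) * eta s u)%:C)
    (fun u => (1 - eta s u)%:C).

Lemma ZtildeE : Ztilde s = (fun w => \prod_a (input_factor a w)^-1).
Proof. by []. Qed.

Lemma input_factor_real a x :
  input_factor a x%:C = (1 - delta s * gen_in s a x)%:C.
Proof.
rewrite /input_factor /factor /gen_in mulrDr opprD addrA !rmorphB rmorph1.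
congr (_ - _); rewrite mulr_sumr rmorph_sum; apply: eq_bigr => u _.
rewrite -(rmorph1 (real_complex R)) -!rmorphM -rmorphB -fmorphV -rmorphM.
by rewrite /gen_out !mulrA.
Qed.

Definition denom_gt0 a (x : R) :=
  forall u, 0 < muR s a (inr u) -> 0 < 1 - (1 - eta s u) * x.

Let delta_pos : 0 < delta s := delta_gt0 Xstar skip_lt1.
Let delta_lt : delta s < 1 := delta_lt1 match_lt1.

Lemma muR_neq0_gt0 a u : muR s a (inr u) != 0 -> 0 < muR s a (inr u).
Proof. by move=> mu_neq0; rewrite lt0r mu_neq0 muR_ge0. Qed.

Lemma denom_gt0_neq0 a x : denom_gt0 a x ->
  denom_neq0 (fun u => (delta s * muR s a (inr u) * eta s u)%:C)
    (fun u => (1 - eta s u)%:C) x%:C.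
Proof.
move=> dx u; rewrite fmorph_eq0 !mulf_eq0 !negb_or => /andP[/andP[_ mu_neq0] _].
rewrite -rmorphM -(rmorph1 (real_complex R)) -rmorphB fmorph_eq0.
by rewrite gt_eqF // dx // muR_neq0_gt0.
Qed.

Lemma exists_out a : exists u, 0 < muR s a (inr u).
Proof.
apply: contrapT => none; have := skip_lt1 a.
rewrite -(muR_in_out Xstar a) ltrDl big1 ?ltxx // => u _.
apply: contrapT => /eqP mu_neq0; apply: none; exists u; exact: muR_neq0_gt0.
Qed.

(** At a real point all terms are nonnegative, and an output state entered on reading [a] with
    positive probability contributes a positive one. *)
Lemma input_slope_neq0 a x : denom_gt0 a x ->
  slope (fun u => (delta s * muR s a (inr u) * eta s u)%:C)
    (fun u => (1 - eta s u)%:C) x%:C x%:C != 0.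
Proof.
move=> dx; pose t u := delta s * muR s a (inr u) * eta s u
   / (1 - (1 - eta s u) * x) / (1 - (1 - eta s u) * x).
have -> : slope (fun u => (delta s * muR s a (inr u) * eta s u)%:C)
    (fun u => (1 - eta s u)%:C) x%:C x%:C = (\sum_u t u)%:C.
  rewrite rmorph_sum; apply: eq_bigr => u _.
  by rewrite !(rmorphM, fmorphV, rmorphB, rmorph1).
rewrite fmorph_eq0 gt_eqF //.
have t_gt0 u : 0 < muR s a (inr u) -> 0 < t u.
  by move=> mu_gt0; rewrite /t !divr_gt0 ?dx // !mulr_gt0 // eta_gt0.
have t_ge0 u : 0 <= t u.
  have [mu0|/muR_neq0_gt0/t_gt0/ltW //] := eqVneq (muR s a (inr u)) 0.
  by rewrite /t mu0 mulr0 !mul0r.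
have [u mu_gt0] := exists_out a.
by rewrite (bigD1 u) //= ltr_wpDr ?t_gt0 // sumr_ge0.
Qed.

(** The factor of [a] vanishes at [x], and the nonzero slopes keep all factors nonzero in a
    punctured neighbourhood. *)
Lemma real_pole x : (forall a, denom_gt0 a x) ->
  (exists a, delta s * gen_in s a x = 1) -> is_pole (Ztilde s) x%:C.
Proof.
move=> dx [a eq1]; rewrite ZtildeE.
have xF : w @[w --> (x%:C : R[i]^o)^'] --> (x%:C : R[i]^o) by exact: nbhs_dnbhs.
apply: (@prod_inv_pole R[i] _ _ _ _ (fun b => input_factor b x%:C)) => [b||b].
- by apply: (@cvg_factor R[i]) => //; exact: denom_gt0_neq0.
- by exists a; rewrite input_factor_real eq1 subrr.
- apply: (@factor_neq0_near R[i] _ _ _ _ _ _ x%:C) => //.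
  + exact: nbhs_dnbhs_neq.
  + exact: denom_gt0_neq0.
  + exact: input_slope_neq0.
Qed.

Lemma real_not_pole x : (forall a, denom_gt0 a x) ->
  (forall a, delta s * gen_in s a x < 1) -> ~ is_pole (Ztilde s) x%:C.
Proof.
move=> dx lt1; rewrite ZtildeE.
have xF : w @[w --> (x%:C : R[i]^o)^'] --> (x%:C : R[i]^o) by exact: nbhs_dnbhs.
apply: (@cvg_not_pole R[i] _ _ _ (\prod_a (input_factor a x%:C)^-1)).
apply: (cvg_big (@mul_continuous R[i])) => a _.
apply: (@cvgV R[i]); last by apply: (@cvg_factor R[i]) => //; exact: denom_gt0_neq0.
rewrite input_factor_real fmorph_eq0 gt_eqF //.
by rewrite subr_gt0.
Qed.

Lemma gen_out_le1 u x : x <= 1 -> gen_out s u x <= 1.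
Proof.
move=> x_le1; have e_gt0 := eta_gt0 Xstar u; have e_le1 := eta_le1 Xstar u.
rewrite /gen_out ler_pdivrMr ?mul1r; nra.
Qed.

Lemma gen_in_le1 a x : x <= 1 -> gen_in s a x <= 1.
Proof.
move=> x_le1; rewrite -(muR_in_out Xstar a) lerD2l; apply: ler_sum => u _.
by rewrite ler_piMr ?muR_ge0 ?gen_out_le1.
Qed.

Lemma denom_gt0_le1 a x : x <= 1 -> denom_gt0 a x.
Proof.
move=> x_le1 u _; have := eta_gt0 Xstar u; have := eta_le1 Xstar u; nra.
Qed.

Lemma cvg_gen_in (F : set_system R) {FF : ProperFilter F} a x :
  y @[y --> F] --> x -> denom_gt0 a x ->
  delta s * gen_in s a y @[y --> F] --> delta s * gen_in s a x.
Proof.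
move=> Fx dx; apply: cvgM; first exact: cvg_cst.
apply: cvgD; first exact: cvg_cst.
apply: cvg_big => [|u _]; first exact: add_continuous.
have [->|/muR_neq0_gt0 mu_gt0] := eqVneq (muR s a (inr u)) 0.
  rewrite mul0r; under eq_fun do rewrite mul0r.
  exact: cvg_cst.
apply: cvgM; first exact: cvg_cst.
apply: cvgM; first by apply: cvgM; [exact: cvg_cst|].
apply: cvgV; first by rewrite gt_eqF ?dx.
exact: (@cvg_denom R F _ _ (fun u => 1 - eta s u) x Fx u).
Qed.

Lemma denom_gt0_near (F : set_system R) {FF : ProperFilter F} a x :
  y @[y --> F] --> x -> denom_gt0 a x -> \forall y \near F, denom_gt0 a y.
Proof.
move=> Fx dx; apply: filter_forall => u.
have [->|/muR_neq0_gt0 mu_gt0] := eqVneq (muR s a (inr u)) 0.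
  by apply: nearW => y; rewrite ltxx.
have dF := cvgr_gt _ (@cvg_denom R F _ _ (fun u => 1 - eta s u) x Fx u) _ (dx u mu_gt0).
by near=> y => _; near: y; exact: dF.
Unshelve. all: by end_near. Qed.

(** Strict inequalities make this an open condition, as the supremum argument requires. *)
Definition strictly_admissible x :=
  forall a, denom_gt0 a x /\ delta s * gen_in s a x < 1.

Lemma strictly_admissible_near (F : set_system R) {FF : ProperFilter F} x :
  y @[y --> F] --> x -> strictly_admissible x ->
  \forall y \near F, strictly_admissible y.
Proof.
move=> Fx ax; apply: filter_forall => a; have [dx lt1] := ax a.
apply: filterI; first exact: denom_gt0_near dx.
exact: cvgr_lt _ (cvg_gen_in Fx dx) _ lt1.
Qed.

(* Bounds the denominators away from 0 uniformly in [x]. *)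
Lemma strictly_admissible_denom x a u : 0 <= x -> strictly_admissible x ->
  0 < muR s a (inr u) ->
  delta s * muR s a (inr u) * eta s u * x < 1 - (1 - eta s u) * x.
Proof.
move=> x_ge0 ax mu_gt0; have [dx lt1] := ax a.
rewrite -[ltRHS]mul1r -ltr_pdivrMr ?dx //; apply: le_lt_trans lt1.
have -> : delta s * muR s a (inr u) * eta s u * x / (1 - (1 - eta s u) * x) =
    delta s * (muR s a (inr u) * gen_out s u x) by rewrite /gen_out !mulrA.
rewrite ler_pM2l //.
rewrite /gen_in (bigD1 u) //= addrCA lerDl addr_ge0 ?muR_ge0 ?sumr_ge0 // => v _.
have [->|/muR_neq0_gt0 muv_gt0] := eqVneq (muR s a (inr v)) 0; first by rewrite mul0r.
rewrite mulr_ge0 ?muR_ge0 // /gen_out divr_ge0 ?(ltW (dx _ _)) //.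
by rewrite mulr_ge0 // ltW // eta_gt0.
Qed.

(* The supremum of the strictly admissible points is a pole unless it is [r],
   hence it is [r] by minimality. *)
Lemma min_pole_admissible (r : R) : is_min_pole (Ztilde s) r%:C ->
  1 < r /\ admissible s r.
Proof.
move=> [pole_r min_r].
have r_gt1 : 1 < r.
  (* Up to 1 the generating functions are at most 1, so [delta s < 1] keeps every factor nonzero. *)
  rewrite ltNge; apply/negP => r_le1; apply: real_not_pole pole_r => a.
    exact: denom_gt0_le1.
  apply: le_lt_trans delta_lt; rewrite ler_piMr ?gen_in_le1 //.
  exact: ltW.
split=> //.
pose S := [set x | 1 <= x <= r /\ strictly_admissible x].
have S1 : S 1.
  split=> [|a]; first by rewrite lexx ltW.
  split; first exact: denom_gt0_le1.
  by apply: le_lt_trans delta_lt; rewrite ler_piMr ?gen_in_le1 //; exact: ltW.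
have Sub : ubound S r by move=> x [/andP[]].
have supS : has_sup S by split; [exists 1|exists r].
pose x0 := sup S.
have x0_ge1 : 1 <= x0 by exact: (ub_le_sup supS.2).
have x0_le_r : x0 <= r by apply: ge_sup => //; exists 1.
have dx0 a : denom_gt0 a x0.
  (* On [S], [strictly_admissible_denom] says that [x * (k + (1 - eta s u)) < 1]. The weak form
     passes to the supremum and still gives positivity, because [k > 0]. *)
  move=> u mu_gt0; set k := delta s * muR s a (inr u) * eta s u.
  have k_gt0 : 0 < k by rewrite !mulr_gt0 // eta_gt0.
  have e_le1 := eta_le1 Xstar u.
  have ke_gt0 : 0 < k + (1 - eta s u) by rewrite ltr_wpDr // subr_ge0.
  suff : x0 * (k + (1 - eta s u)) <= 1 by nra.
  rewrite -ler_pdivlMr // mul1r; apply: ge_sup; first by exists 1.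
  move=> x [/andP[x_ge1 _] ax].
  rewrite -[leRHS]mul1r ler_pdivlMr //.
  have := strictly_admissible_denom (le_trans ler01 x_ge1) ax mu_gt0.
  rewrite -/k; nra.
have lex0 a : delta s * gen_in s a x0 <= 1.
  (* By continuity the inequality [gt1] would hold at points of [S] close to [x0]. *)
  rewrite leNgt; apply/negP => gt1.
  have gt1_near : \forall y \near x0, 1 < delta s * gen_in s a y.
    exact: (cvgr_gt _ (@cvg_gen_in (nbhs x0) _ a x0 cvg_id (@dx0 a)) _ gt1).
  have /nbhs_ballP[e /= e_gt0 near_e] := gt1_near.
  have [x Sx] := sup_adherent e_gt0 supS; rewrite -/x0 => x_gt.
  have x_le : x <= x0 by exact: (ub_le_sup supS.2).
  have [_ /(_ a)[_ lt1]] := Sx.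
  have /near_e : ball x0 e x by rewrite /ball /= ger0_norm ?subr_ge0 //; lra.
  by rewrite /= => /(lt_trans lt1); rewrite ltxx.
suff <- : x0 = r by move=> a; split; [exact: dx0|exact: lex0].
have [[a eq1]|none] := pselect (exists a, delta s * gen_in s a x0 = 1).
  have := min_r _ (real_pole dx0 (ex_intro _ a eq1)).
  have norm_real y : 0 <= y -> `|y%:C| = y%:C.
    by move=> y_ge0; rewrite ger0_norm // ler0c.
  rewrite !norm_real ?lecR; [|lra|lra].
  by move=> r_le; apply/eqP; rewrite eq_le x0_le_r.
apply/eqP; rewrite eq_le x0_le_r /= leNgt; apply/negP => x0_lt_r.
have ax0 : strictly_admissible x0.
  move=> a; split; first exact: dx0.
  rewrite lt_neqAle lex0 andbT; apply/eqP => eq1; by apply: none; exists a.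
(* Openness would provide a point of [S] beyond its supremum. *)
have adm_near : \forall x \near x0, x < r /\ strictly_admissible x.
  apply: filterI; first exact: lt_nbhsl.
  exact: (@strictly_admissible_near (nbhs x0) _ x0 cvg_id ax0).
have /nbhs_ballP[e /= e_gt0 near_e] := adm_near.
have [] := near_e (x0 + e / 2).
  by rewrite /ball /= opprD addrA subrr add0r normrN gtr0_norm ?divr_gt0 //; lra.
move=> lt_r adm; have : S (x0 + e / 2) by split=> //; apply/andP; split; lra.
by move=> /(ub_le_sup supS.2); rewrite -/x0; lra.
Qed.

End MinimalPole.

(** * The height of the trie *)

(** For [n > 0] this is n^(-c), written with [expR] to match the final estimate. *)
Lemma cvg_expR_ln (R : realType) (c : R) : 0 < c ->
  expR (- (c * ln n%:R)) @[n --> \oo] --> 0.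
Proof.
move=> c_gt0; apply: (cvg_comp _ (fun x : R => expR (- x))); last exact: cvgr_expR.
apply/cvgryPge => A.
have /cvgryPge/(_ (expR (A / c))) big := @cvgr_idn R.
near=> n.
have n_ge : expR (A / c) <= n%:R :> R by near: n; exact: big.
rewrite mulrC -ler_pdivrMr // -[leLHS]expRK ler_ln ?posrE ?expR_gt0 //.
exact: lt_le_trans (expR_gt0 _) n_ge.
Unshelve. all: by end_near. Qed.

Theorem theorem2 (R : realType) (Sigma : finType) (X : pfa R Sigma)
    (s : instate X) (ztilde : R[i]) (gamma : R)
    (Xstar : star_like s) (Xcanonical : in_canonical_form s)
    (skip_lt1 : forall a : Sigma, muR s a (inl s) < 1)
    (match_lt1 : forall a b : Sigma, match_term s a b < 1)
    (ztildeP : is_min_pole (Ztilde s) ztilde)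
    (gammaE : gamma%:C = ztilde^-1) :
  exists n0 : nat, forall eps : R, 0 < eps ->
    exists o : nat -> R, o n @[n --> \oo] --> (0 : R) /\
      forall n : nat, (n0 <= n)%N ->
        (height X [set: nat -> Sigma] n <=
         (2 * (Num.ceil ((1 + eps) * logb gamma^-1 n%:R))%:~R + o n)%:E)%E.
Proof.
set r := gamma^-1.
(* Since [gamma] is real, so is the pole. *)
have ztildeE : ztilde = r%:C by rewrite -[ztilde]invrK -gammaE /r fmorphV.
have [r_gt1 radm] : 1 < r /\ admissible s r.
  by apply: min_pole_admissible; rewrite -?ztildeE.
have delta_bnd : 0 < delta s <= 1.
  by rewrite (delta_gt0 Xstar skip_lt1) ltW // delta_lt1.
have r_gt0 : 0 < r by lra.
have lnr_gt0 : 0 < ln r by exact: ln_gt0.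
have rV_lt1 : r^-1 < 1 by rewrite invf_lt1.
pose D := 2 / delta s / (1 - r^-1).
have D_ge0 : 0 <= D.
  by rewrite !divr_ge0 ?subr_ge0 ?(ltW rV_lt1) //; case/andP: delta_bnd => /ltW.
exists 1%N => eps eps_gt0.
(* The error term is D n^(-2 eps). *)
exists (fun n => D * expR (- (2 * eps * ln n%:R))); split.
  rewrite -[X in _ --> X](mulr0 D); apply: cvgM; first exact: cvg_cst.
  by apply: cvg_expR_ln; rewrite mulr_gt0.
move=> n n_gt0.
have n_ge1 : 1 <= n%:R :> R by rewrite ler1n.
have lnn_ge0 : 0 <= ln (n%:R : R) by exact: ln_ge0.
set m := Num.ceil _.
have log_ge0 : 0 <= (1 + eps) * logb r n%:R.
  by rewrite mulr_ge0 ?divr_ge0 ?(ltW lnr_gt0) // addr_ge0 // ltW.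
have m_ge0 : 0 <= m by rewrite ceil_ge0 (lt_le_trans _ log_ge0).
(* With this cut-off r^(-L) is at most n^(-2(1 + eps)), which outweighs the n^2 pairs. *)
pose L := (2 * `|m|)%N.
have LE : L%:R = 2 * m%:~R :> R by rewrite natrM natr_absz ger0_norm.
have L_ge : 2 * (1 + eps) * ln (n%:R : R) <= L%:R * ln r.
  rewrite LE -!mulrA ler_pM2l // -ler_pdivrMr // -mulrA.
  exact: ceil_ge.
apply/ereal_supP => _ [u [_ _ [d [T [P [rho [rhoP ->]]]]]]].
apply: le_trans (integral_max_lcp Xstar Xcanonical rhoP L delta_bnd r_gt1 radm) _.
rewrite lee_fin LE lerD2l.
have -> : n%:R ^+ 2 * (2 / delta s) * r ^- L.+1 / (1 - r^-1) =
    D * (n%:R ^+ 2 * r ^- L.+1) by rewrite /D; ring.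
rewrite ler_wpM2l //.
(* The extra factor [r^-1] is at most 1 and is dropped. *)
apply: (@le_trans _ _ (n%:R ^+ 2 * r ^- L)).
  rewrite ler_wpM2l ?exprn_ge0 // lef_pV2 ?posrE ?exprn_gt0 //.
  by rewrite ler_eXn2l // ltnW.
have n_pos : (n%:R : R) \is Num.pos by rewrite posrE ltr0n.
rewrite -[X in X ^+ 2](lnK n_pos) -{1}(@lnK R r) ?posrE //.
rewrite -!expRM_natl -expRN -expRD ler_expR.
lra.
Qed.
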